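(* For all integers $n,k\ge 0$, the coefficient $g_{n+k,n}$ of $x^n$ in $\hat p_{n+k}(x)$ is $$g_{n+k,n}=\sum_{\mu\subseteq (k)\times(2n+1)} u_n(\mu),$$ where the sum is over all partitions $\mu=(\mu_1,\dots,\mu_k)$ with $2n+1\ge\mu_1\ge\cdots\ge\mu_k\ge 0$.
   Context: Let $\alpha,\beta,\epsilon_1,\epsilon_2,q$ be indeterminates. $[i]_q=1+q+\cdots+q^{i-1}$ for $i\ge0$ (so $[0]_q=0$) and $\binom{n}{k}_q$ is the usual $q$-binomial coefficient. Empty products equal $1$. The transformed Al-Salam-Chihara polynomials $(\hat p_n(x))_{n\ge0}$ are defined by $\hat p_{-1}(x)=0$, $\hat p_0(x)=1$ and, for $n\ge0$, $\hat p_{n+1}(x)=(x+b_n)\hat p_n(x)-\lambda_n\hat p_{n-1}(x)$, where $b_n=(\alpha+\beta)q^n+(\epsilon_1+\epsilon_2)[n]_q$ and $\lambda_n=\epsilon_1\epsilon_2[n]_q[n-1]_q+(\alpha\epsilon_2+\beta\epsilon_1)q^{n-1}[n]_q+\alpha\beta(q^{2n-1}-q^{n-1})$ (for $n\ge1$; $\lambda_0$ plays no role). For $i\ge0$ put $X_i=\alpha q^i+\epsilon_1[i]_q$ and $Y_i=\beta q^i+\epsilon_2[i]_q$. For $j\ge0$ put $Z_j=X_{j/2}$ if $j$ is even and $Z_j=Y_{(j-1)/2}$ if $j$ is odd. A partition $\mu=(\mu_1,\dots,\mu_l)$ is a weakly decreasing sequence of nonnegative integers (zeros are allowed and counted in the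 length $l$). $\mu\subseteq(r)\times(s)$ means $\mu$ has exactly $r$ entries (zeros allowed), all at most $s$. For $m\ge0$ define $s_m(\mu)=\min(|\{i:\mu_i=0\}|,|\{i:\mu_i=2m+1\}|)$ if $\mu_1=2m+1$, and $s_m(\mu)=0$ otherwise (including for the empty partition). With $t=s_m(\mu)$ define the weight $$u_m(\mu)=\Big(\prod_{i=1}^{l-t}Z_{\mu_{l+1-i}+2(i-1)}\Big)\binom{m+l}{t}_q Y_0Y_1\cdots Y_{t-1}.$$ *)

(* Defs.v *)
From mathcomp Require Import all_boot all_order all_algebra.
From mathcomp Require Import mpoly.

Set Implicit Arguments.
Unset Strict Implicit.
Unset Printing Implicit Defensive.

Import GRing.Theory.
Local Open Scope ring_scope.

Section AlSalamChihara.

Variables (F : fieldType) (alpha beta eps1 eps2 q : F).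

Definition qint (i : nat) : F := \sum_(j < i) q ^+ j.

Definition qfact (n : nat) : F := \prod_(1 <= i < n.+1) qint i.

(* The quotient is meaningful when no qint i with i > 0 vanishes, which is
   the case for an indeterminate q. *)
Definition qbinom (n k : nat) : F :=
  if (k <= n)%N then qfact n / (qfact k * qfact (n - k)) else 0.

Definition b_ (n : nat) : F :=
  (alpha + beta) * q ^+ n + (eps1 + eps2) * qint n.

(* Exponents are truncated at n = 0; lambda_ 0 only ever multiplies the zero
   polynomial standing for phat (-1). *)
Definition lambda_ (n : nat) : F :=
  eps1 * eps2 * qint n * qint n.-1
  + (alpha * eps2 + beta * eps1) * q ^+ n.-1 * qint n
  + alpha * beta * (q ^+ (2 * n).-1 - q ^+ n.-1).

Fixpoint phat (n : nat) : {poly F} :=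
  match n with
  | 0 => 1
  | n'.+1 =>
      ('X + (b_ n')%:P) * phat n'
      - lambda_ n' *: (match n' with 0 => 0 | n''.+1 => phat n'' end)
  end.

Definition X_ (i : nat) : F := alpha * q ^+ i + eps1 * qint i.

Definition Y_ (i : nat) : F := beta * q ^+ i + eps2 * qint i.

Definition Z_ (j : nat) : F := if odd j then Y_ (j.-1)./2 else X_ j./2.

(* For the empty sequence the default head 0 differs from 2m+1. *)
Definition s_ (m : nat) (mu : seq nat) : nat :=
  if head 0%N mu == (2 * m).+1
  then minn (count_mem 0%N mu) (count_mem (2 * m).+1 mu)
  else 0%N.

(* nth is 0-based: the part mu_{l+1-i} is nth 0 mu (l - i). *)
Definition u_ (m : nat) (mu : seq nat) : F :=
  let l := size mu in
  let t := s_ m mu in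
  (\prod_(1 <= i < (l - t).+1) Z_ (nth 0%N mu (l - i) + 2 * (i - 1)))
  * qbinom (m + l) t * \prod_(i < t) Y_ i.

End AlSalamChihara.

(* Partitions contained in (r) x (s): weakly decreasing r-tuples of integers
   in [0, s]. *)
Definition in_box (r s : nat) (mu : r.-tuple 'I_s.+1) : bool :=
  sorted geq [seq val i | i <- mu].

(* The field of rational functions over K in five indeterminates. *)
Definition ratfun5 (K : idomainType) : fieldType := {fraction {mpoly K[5]}}.

Definition indet (K : idomainType) (i : nat) : ratfun5 K :=
  tofrac ('X_(inord i) : {mpoly K[5]}).

(* Main.v *)
(* Put N = n + k and read mu backwards as a_i = mu_(k+1-i) + 2(i-1): partitions
   become k-subsets of {0, ..., 2N-1} without two consecutive elements, so the
   sum of the products Z_(a_1) ... Z_(a_k) is a coefficient of a continuant,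
   that is of a polynomial R(0, N) with
     R(a, b+1) = (x + b_b) R(a, b) - X_b Y_(b-1) R(a, b-1),
   and this also satisfies the mirror recurrence in a.  Removing simultaneously
   one largest part 2n+1 and one part 0 as long as possible expresses the sum of
   the weights u_n through the R(t, N-t); by Abel summation it equals
     R(0, N) + (beta - eps2) sum_(t >= 1) D_t(N) E_t R(t, N-t),
     D_t(N) = (binom(N, t) - binom(N, t-1)) / q,
     E_t = X_(t-1) prod_(i < t-1) X_i Y_i.
   Since lambda_N = X_N Y_(N-1) - alpha (beta - eps2) q^(N-1), this expression
   satisfies the recurrence of phat_N: write D_t(N) = a_t + c_t with
   c_t = - q^(N-t) binom(N, t-1), apply the recurrence in b with coefficient a_t
   and the one in a with coefficient c_t, and the sum over t telescopes. *)
Require Import Defs.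
From mathcomp Require Import all_boot all_order all_algebra.
From mathcomp Require Import mpoly.
From mathcomp Require Import ring zify.

Set Implicit Arguments.
Unset Strict Implicit.
Unset Printing Implicit Defensive.

Import GRing.Theory.
Local Open Scope ring_scope.

Section Generic.

Variables (F : fieldType) (alpha beta eps1 eps2 q : F).
Hypothesis q_neq0 : q != 0.
Hypothesis expq_neq1 : forall i, (0 < i)%N -> q ^+ i != 1.

Local Notation qint := (qint q).
Local Notation qbinom := (qbinom q).
Local Notation X_ := (X_ alpha eps1 q).
Local Notation Y_ := (Y_ beta eps2 q).
Local Notation Z_ := (Z_ alpha beta eps1 eps2 q).
Local Notation b_ := (b_ alpha beta eps1 eps2 q).
Local Notation lambda_ := (lambda_ alpha beta eps1 eps2 q).
Local Notation phat := (phat alpha beta eps1 eps2 q).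

(** * q-binomial coefficients *)

Lemma subr1q_neq0 : 1 - q != 0.
Proof. by rewrite subr_eq0 eq_sym -(expr1 q) expq_neq1. Qed.

Lemma subr1X_neq0 i : (0 < i)%N -> 1 - q ^+ i != 0.
Proof. by move=> i_gt0; rewrite subr_eq0 eq_sym expq_neq1. Qed.

(** Turns later identities into rational identities in [q] and its powers, which [field] decides
    since no [1 - q ^+ i] with [i > 0] vanishes. *)
Lemma qintE i : qint i = (1 - q ^+ i) / (1 - q).
Proof.
apply: (canRL (mulfK subr1q_neq0)).
by rewrite -[1 - q ^+ i]opprB subrX1 -mulNr opprB mulrC.
Qed.

Lemma qint_neq0 i : (0 < i)%N -> qint i != 0.
Proof. by move=> ?; rewrite qintE mulf_neq0 ?invr_neq0 ?subr1X_neq0 ?subr1q_neq0. Qed.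

Lemma qfactS n : qfact q n.+1 = qint n.+1 * qfact q n.
Proof. by rewrite /qfact big_nat_recr //= mulrC. Qed.

Lemma qfact_neq0 n : qfact q n != 0.
Proof.
elim: n => [|n IHn]; first by rewrite /qfact big_nil oner_eq0.
by rewrite qfactS mulf_neq0 ?qint_neq0.
Qed.

Lemma qbinom0 n : qbinom n 0 = 1.
Proof.
rewrite /Defs.qbinom leq0n subn0 {2}/qfact big_nil mul1r divff //.
exact: qfact_neq0.
Qed.

Lemma qbinom_small n k : (n < k)%N -> qbinom n k = 0.
Proof. by rewrite ltnNge /Defs.qbinom => /negbTE->. Qed.

Lemma qbinomSr m k :
  qbinom (k + m) k.+1 = qbinom (k + m) k * qint m / qint k.+1.
Proof.
case: m => [|m].
  by rewrite addn0 qbinom_small // (qintE 0) subrr mul0r mulr0 mul0r.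
rewrite /Defs.qbinom leq_addr addnS leq_addr.
rewrite -addnS addKn addnS -addSn addKn !qfactS.
by field; rewrite !qint_neq0 ?qfact_neq0.
Qed.

Lemma qbinomSl m k :
  qbinom (k + m) k = qbinom (k + m).+1 k * qint m.+1 / qint (k + m).+1.
Proof.
rewrite /Defs.qbinom leq_addr -addnS leq_addr !addKn addnS !qfactS.
by field; rewrite !qint_neq0 ?qfact_neq0.
Qed.

Lemma qbinomS n k : (k <= n)%N ->
  qbinom n.+1 k.+1 = qbinom n k.+1 + q ^+ (n - k) * qbinom n k.
Proof.
move=> /subnKC; move: (n - k)%N => m <-.
have -> : qbinom (k + m).+1 k.+1 = qbinom (k + m) k * qint (k + m).+1 / qint k.+1.
  rewrite -addnS qbinomSr (qbinomSl m) addnS.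
  by field; rewrite !qint_neq0.
rewrite qbinomSr !qintE -addSn exprD.
field.
by rewrite subr1X_neq0 ?subr1q_neq0.
Qed.

(* In the notation above, with [t = r.+1]: D_t(N), then c_t, then X_i Y_(i-1). *)
Definition qballot r N : F := (qbinom N r.+1 - qbinom N r) / q.
Definition qshift r N : F := - (q ^+ (N - r.+1) * qbinom N r).
Definition jump i : F := X_ i * Y_ i.-1.

Lemma b_E i : b_ i = X_ i + Y_ i.
Proof. by rewrite /Defs.b_ /Defs.X_ /Defs.Y_; ring. Qed.

Lemma lambda_E i :
  lambda_ i.+1 = jump i.+1 - alpha * (beta - eps2) * q ^+ i.
Proof.
rewrite /Defs.lambda_ /jump /Defs.X_ /Defs.Y_ !qintE.
have -> : ((2 * i.+1).-1 = (i + i).+1)%N by lia.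
rewrite /=.
rewrite !exprS !exprD.
by field; rewrite subr1q_neq0.
Qed.

(** Pascal's rule in both binomials gives D_t(N+1) = a_t + c_(t-1); the shifted index is what makes
    the later sum telescope. *)
Lemma qballotS r N : (r.+1 < N)%N ->
  qballot r.+1 N.+1 = qballot r.+1 N - qshift r.+1 N + qshift r N.
Proof.
move=> lt_r1N; have lt_rN := ltnW lt_r1N.
rewrite /qballot /qshift (qbinomS (ltnW lt_r1N)) (qbinomS (ltnW lt_rN)).
rewrite -(subnSK lt_rN) -(subnSK lt_r1N) !exprS.
by field.
Qed.

Lemma qballot0S N : (0 < N)%N -> qballot 0 N.+1 = qballot 0 N - qshift 0 N.
Proof.
case: N => // N _; rewrite /qballot /qshift qbinomS // !qbinom0 subn0 subn1.
by rewrite exprS; field.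
Qed.

Lemma qballot_b r N : (r.+1 < N)%N ->
  (qballot r N - qshift r N) * b_ (N - r.+1) + qshift r N * b_ r =
  qballot r N * b_ N.
Proof.
move=> /subnKC; move: (N - _)%N => m <-.
rewrite /qballot /qshift /Defs.b_ addSnnS addSnnS qbinomSr !qintE.
have -> : (r + m.+2 - r.+1 = m.+1)%N by lia.
rewrite !exprD !exprS.
field.
by rewrite -exprS subr1X_neq0 ?subr1q_neq0 ?q_neq0.
Qed.

(** Collects the two coefficients of [wcont r N]: one from the recurrence at the right end for [r],
    one from the recurrence at the left end for [r.+1], where [wXS] yields the jump. *)
Lemma qballot_jump r N : (r.+1 < N)%N ->
  (qballot r N - qshift r N) * jump (N - r.+1) + qshift r.+1 N * jump r.+1 =
  lambda_ N * qballot r N.-1.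
Proof.
move=> /subnKC; move: (N - _)%N => m <-.
rewrite [(r.+2 + m)%N]addSn addSn lambda_E /=.
(* All binomials are reduced to [qbinom N r] with [N = (r + m).+2]. *)
have := qbinomSr m.+2 r; have := qbinomSr m.+1 r; have := qbinomSl m.+1 r.
rewrite !addnS => qbinomN1 qbinomN1S qbinomNS.
rewrite /qballot /qshift qbinomN1S qbinomNS qbinomN1 /jump.
have -> : ((r + m).+2 - r.+1 = m.+1)%N by lia.
have -> : ((r + m).+2 - r.+2 = m)%N by lia.
rewrite /Defs.X_ /Defs.Y_ !qintE /= -2!addSn.
rewrite !exprD !exprS.
field.
by rewrite -!exprS -exprD !subr1X_neq0 ?subr1q_neq0 ?q_neq0.
Qed.

(** With t = r+1, this follows from [t] binom(N, t) = [N-t+1] binom(N, t-1) and q [i] = [i+1] - 1,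
    applied to the [eps2] and [beta] parts of [Y_] separately. *)
Lemma qballotE r N : (r < N)%N ->
  qbinom N r.+1 * Y_ r - qbinom N r * Y_ (N - r.+1) =
  (beta - eps2) * qballot r N.
Proof.
move=> /subnKC; move: (N - _)%N => m <-.
rewrite /qballot /Defs.Y_ addSnnS qbinomSr !qintE.
rewrite !exprS.
field.
by rewrite -exprS subr1X_neq0 ?subr1q_neq0 ?q_neq0.
Qed.

(** * Continuants *)

(** This is R(c, c + L): the second argument is a length, so [cont t N] below is R(t, N - t). *)
Fixpoint continuant c L : {poly F} :=
  if L is L'.+1 then
    ('X + (b_ (c + L'))%:P) * continuant c L'
    - jump (c + L') *: (if L' is L''.+1 then continuant c L'' else 0)
  else 1.

Lemma continuantSS c L :
  continuant c L.+2 = ('X + (b_ (c + L.+1))%:P) * continuant c L.+1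
                      - jump (c + L.+1) *: continuant c L.
Proof. by []. Qed.

Lemma continuant1 c : continuant c 1 = 'X + (b_ c)%:P.
Proof. by rewrite /= scaler0 subr0 mulr1 addn0. Qed.

(** Both sides satisfy the same second-order recurrence in [L], hence the induction on two
    consecutive lengths. *)
Lemma continuantSl c L :
  continuant c L.+2 = ('X + (b_ c)%:P) * continuant c.+1 L.+1
                      - jump c.+1 *: continuant c.+2 L.
Proof.
have [] : continuant c L.+2 = ('X + (b_ c)%:P) * continuant c.+1 L.+1
                      - jump c.+1 *: continuant c.+2 L /\
  continuant c L.+3 = ('X + (b_ c)%:P) * continuant c.+1 L.+2
                      - jump c.+1 *: continuant c.+2 L.+1 => //.
elim: L => [|L [IH0 IH1]].
  rewrite !continuantSS !continuant1 /= !addnS ?addn0 -!mul_polyC.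
  by split; ring.
split=> //; rewrite continuantSS IH1 IH0 (continuantSS c.+1 L.+1) (continuantSS c.+2 L).
by rewrite -!mul_polyC !addSn !addnS; ring.
Qed.

(* Extended by 0 to [N < 2 * t], so that the index [t] may be shifted freely. *)
Definition cont t N : {poly F} :=
  if (2 * t <= N)%N then continuant t (N - 2 * t) else 0.

Lemma cont_small t N : (N < 2 * t)%N -> cont t N = 0.
Proof. by rewrite ltnNge /cont => /negbTE->. Qed.

Lemma contSr t N : (2 * t <= N.+1)%N ->
  cont t N.+2 = ('X + (b_ (N.+1 - t))%:P) * cont t N.+1
                - jump (N.+1 - t) *: cont t N.
Proof.
move=> /subnKC; case: (N.+1 - _)%N => [|L].
  (* Boundary case [2 * t = N.+1]: [cont t N] is the extension by 0 and [cont t N.+1] is 1. *)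
  rewrite addn0 => eN; rewrite -addn1 -eN [cont t N]cont_small; last by lia.
  rewrite /cont leqnn leq_addr addKn subnn continuant1 scaler0 subr0 mulr1.
  by rewrite (_ : 2 * t - t = t)%N //; lia.
rewrite addnS => -[<-]; rewrite /cont.
do 3![rewrite ifT; last by lia].
rewrite -!addnS !addKn addnS continuantSS.
by rewrite (_ : (2 * t + L).+1 - t = t + L.+1)%N //; lia.
Qed.

Lemma contSl t N : (2 * t.+1 <= N.+1)%N ->
  cont t N = ('X + (b_ t)%:P) * cont t.+1 N.+1 - jump t.+1 *: cont t.+2 N.+2.
Proof.
move=> /subnKC; case: (N.+1 - _)%N => [|L] eN.
  rewrite [cont t.+2 _]cont_small; last by lia.
  rewrite scaler0 subr0 /cont -eN addn0 leqnn subnn mulr1 ifT; last by lia.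
  by rewrite (_ : N - 2 * t = 1)%N ?continuant1 //; lia.
rewrite /cont; do 3![rewrite ifT; last by lia].
rewrite (_ : N.+1 - 2 * t.+1 = L.+1)%N; last by lia.
rewrite (_ : N - 2 * t = L.+2)%N; last by lia.
rewrite (_ : N.+2 - 2 * t.+2 = L)%N; last by lia.
exact: continuantSl.
Qed.

(** * The recurrence of the corrected sum of continuants *)

Definition wX r : F := X_ r * \prod_(i < r) (X_ i * Y_ i).
(** With t = r+1, this is E_t R(t, N-t). *)
Definition wcont r N : {poly F} := wX r *: cont r.+1 N.

Lemma wXS r : wX r.+1 = jump r.+1 * wX r.
Proof. by rewrite /wX /jump big_ord_recr /=; ring. Qed.

Lemma wX0 : wX 0 = alpha.
Proof.
by rewrite /wX big_ord0 mulr1 /Defs.X_ qintE subrr mul0r mulr0 addr0 mulr1.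
Qed.

Lemma wcont_small r N : (N < 2 * r.+1)%N -> wcont r N = 0.
Proof. by move=> ?; rewrite /wcont cont_small ?scaler0. Qed.

(** The two central binomials of an odd row agree by symmetry. *)
Lemma qballot_mid r : qballot r r.*2.+1 = 0.
Proof.
rewrite /qballot -addnn -addnS qbinomSr mulfK ?subrr ?mul0r //.
exact: qint_neq0.
Qed.

(* For [N = 2 r] both recurrences of [cont] fail, with cancelling defects. *)
Lemma wcontX r N :
  qballot r N.+1 *: ('X * wcont r N.+1) =
  (qballot r N.+1 - qshift r N.+1) *:
    (wcont r N.+2 - b_ (N - r) *: wcont r N.+1 + jump (N - r) *: wcont r N)
  + qshift r N.+1 *:
    (wcont r.+1 N.+2 + wX r *: cont r N - b_ r *: wcont r N.+1).
Proof.
have [le_rN|lt_Nr] := leqP (2 * r.+1) N.+1.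
  rewrite (contSl le_rN) /wcont (contSr le_rN) subSS wXS.
  move: (qballot _ _) (qshift _ _) (wX r) (jump _) (jump _) => D s w j1 j2.
  by rewrite -!mul_polyC !(polyCB, polyCM); ring.
rewrite !(@wcont_small r N.+1, @wcont_small r N, @wcont_small r.+1 N.+2);
  try by lia.
rewrite mulr0 !scaler0 !addr0 !subr0 add0r.
have [lt_N2r|] := ltnP N (2 * r).
  rewrite wcont_small; last by lia.
  by rewrite cont_small // !scaler0 addr0.
move=> le_2rN; have -> : N = r.*2 by lia.
rewrite qballot_mid sub0r /wcont /cont -mul2n leqnn subnn ifT; last by lia.
rewrite (_ : (2 * r).+2 - 2 * r.+1 = 0)%N; last by lia.
by rewrite scaleNr addNr.
Qed.

(** A common bound [M] lets the sums for [N], [N.+1] and [N.+2] share one range; terms with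
    [N < 2 * r.+1] vanish. *)
Definition qballot_sum M N : {poly F} :=
  \sum_(0 <= r < M) qballot r N *: wcont r N.

(** The inhomogeneous term is the lower boundary of the telescoping sum. Multiplied by
    [beta - eps2], it accounts for the gap between [lambda_ N.+1] and [jump N.+1]. *)
Lemma qballot_sum_rec M N : (N.+2 <= M)%N ->
  qballot_sum M N.+2 = ('X + (b_ N.+1)%:P) * qballot_sum M N.+1
    - lambda_ N.+1 *: qballot_sum M N + (alpha * q ^+ N) *: cont 0 N.
Proof.
move=> le_NM.
(* [G] carries the c_(t-1) of [qballotS], and [H] the longer continuant from the recurrence at the
   left end. *)
pose G r := if r is r'.+1 then - (qshift r' N.+1 *: wcont r N.+2) else 0.
pose H r := qshift r N.+1 *: (wX r *: cont r N).
have term r :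
    qballot r N.+2 *: wcont r N.+2
    - ('X + (b_ N.+1)%:P) * (qballot r N.+1 *: wcont r N.+1)
    + lambda_ N.+1 *: (qballot r N *: wcont r N) =
    (G r.+1 + H r.+1) - (G r + H r).
  have -> : qballot r N.+2 *: wcont r N.+2 =
      (qballot r N.+1 - qshift r N.+1) *: wcont r N.+2 - G r.
    have [lt_Nr|le_rN] := ltnP N.+2 (2 * r.+1).
      rewrite wcont_small // /G !scaler0 sub0r; case: r lt_Nr => [|r] lt_Nr.
        by rewrite oppr0.
      by rewrite wcont_small // scaler0 !oppr0.
    case: r le_rN => [|r] le_rN; first by rewrite qballot0S // subr0.
    rewrite qballotS; last by lia.
    by rewrite scalerDl /G (opprK (_ *: _)).
  (* Where the bound required by the coefficient identity fails, [wcont] vanishes. *)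
  have Eb : qballot r N.+1 * b_ N.+1 *: wcont r N.+1 =
      ((qballot r N.+1 - qshift r N.+1) * b_ (N - r) + qshift r N.+1 * b_ r)
        *: wcont r N.+1.
    have [lt_Nr|le_rN] := ltnP N.+1 (2 * r.+1).
      by rewrite wcont_small // !scaler0.
    by rewrite -qballot_b ?subSS //; lia.
  have Ej : lambda_ N.+1 * qballot r N *: wcont r N =
      ((qballot r N.+1 - qshift r N.+1) * jump (N - r)
       + qshift r.+1 N.+1 * jump r.+1) *: wcont r N.
    have [lt_Nr|le_rN] := ltnP N (2 * r.+1).
      by rewrite wcont_small // !scaler0.
    by rewrite -(@qballot_jump r N.+1) ?subSS //; lia.
  rewrite -scalerAr mulrDl scalerDr mul_polyC !(scalerA _ _ (wcont r _)) wcontX Eb Ej.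
  rewrite /G /H wXS /wcont -scalerA.
  move: (qballot _ _) (qshift _ _) (qshift _ _) (wX r) (jump _) (jump _).
  move=> D s s' w j1 j2.
  rewrite -!mul_polyC !(polyCM, polyCB, polyCD, polyCN).
  ring.
have := telescope_sumr (fun r => G r + H r) (leq0n M).
under eq_bigr do rewrite -term.
rewrite !big_split /= sumrN -mulr_sumr -scaler_sumr => E.
have GM : G M + H M = 0.
  case: M {E} le_NM => // M le_NM.
  rewrite /G /H wcont_small; last by lia.
  by rewrite cont_small ?scaler0 ?oppr0 ?addr0 //; lia.
have G0 : G 0 + H 0 = - ((alpha * q ^+ N) *: cont 0 N).
  by rewrite /G /H add0r wX0 /qshift qbinom0 subn1 mulr1 scaleNr scalerA mulrC.
rewrite GM G0 sub0r opprK in E.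
rewrite -E /qballot_sum; ring.
Qed.

Lemma phatE M N : (N <= M)%N ->
  phat N = cont 0 N + (beta - eps2) *: qballot_sum M N.
Proof.
have base L : (L < 2)%N -> qballot_sum M L = 0.
  move=> lt_L2; rewrite /qballot_sum big1 // => r _.
  by rewrite wcont_small ?scaler0 //; lia.
pose P L := (L <= M)%N ->
  phat L = cont 0 L + (beta - eps2) *: qballot_sum M L.
suff [] : P N /\ P N.+1 by [].
elim: N => [|N [IH0 IH1]].
  split=> _; rewrite base // scaler0 addr0 /cont //=.
  by rewrite !scaler0 !subr0.
split=> // le_N2M; have le_N1M := ltnW le_N2M; have le_NM := ltnW le_N1M.
rewrite [LHS]/= -/(phat N.+1) -/(phat N) (IH0 le_NM) (IH1 le_N1M) lambda_E.
rewrite (qballot_sum_rec le_N2M) contSr // subn0 lambda_E.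
move: (qballot_sum _ _) (qballot_sum _ _) (jump _) (b_ _) => S1 S0 j b.
by rewrite -!mul_polyC !(polyCM, polyCB); ring.
Qed.

Definition qweight N t : F := qbinom N t * \prod_(i < t) Y_ i.

(** Abel summation of [phatE]. The [t]-th difference isolates the partitions from which exactly [t]
    pairs can be removed: the subtracted term accounts for one more part 0 and one more largest
    part. *)
Lemma phat_sum N :
  phat N = \sum_(0 <= t < N.+1) (\prod_(i < t) X_ i * qweight N t) *:
             (cont t N - (X_ t * Y_ (N - t.+1)) *: cont t.+1 N).
Proof.
have bal t : (beta - eps2) *: (qballot t N *: wcont t N) =
    (\prod_(i < t.+1) X_ i * qweight N t.+1) *: cont t.+1 N
    - (\prod_(i < t) X_ i * qweight N t) *:
        ((X_ t * Y_ (N - t.+1)) *: cont t.+1 N).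
  have [lt_tN|le_Nt] := ltnP t N; last first.
    by rewrite /wcont !cont_small ?scaler0 ?subr0 //; lia.
  rewrite /wcont !scalerA -qballotE // -scalerBl.
  congr (_ *: _); rewrite /wX big_split /qweight !big_ord_recr /=.
  by ring.
rewrite (@phatE N) // /qballot_sum.
under [RHS]eq_bigr do rewrite scalerBr.
(* The first sum loses its term [t = 0]; the second loses [t = N], where [cont N.+1 N] is 0. *)
rewrite sumrB big_nat_recl // [X in _ = _ - X]big_nat_recr //=.
rewrite [cont N.+1 N]cont_small; last by lia.
rewrite !scaler0 addr0 -addrA -sumrB big_ord0 mul1r.
rewrite {1}/qweight qbinom0 big_ord0 mul1r scale1r scaler_sumr; congr (_ + _).
by apply: eq_bigr => t _; rewrite bal.
Qed.

Lemma Z_even i : Z_ (2 * i) = X_ i.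
Proof. by rewrite /Defs.Z_ mul2n odd_double doubleK. Qed.

Lemma Z_odd i : Z_ (2 * i).+1 = Y_ i.
Proof. by rewrite /Defs.Z_ mul2n oddS odd_double /= doubleK. Qed.

(** * Partitions in a box *)

(** Plain sequences of naturals let boxes of different bounds be compared by [perm_eq], without
    casts between ordinal types. *)
Definition box k s : seq (seq nat) :=
  [seq [seq val i | i <- mu] | mu : k.-tuple 'I_s.+1 in @in_box k s].

Lemma big_box k s (f : seq nat -> F) :
  \sum_(mu : k.-tuple 'I_s.+1 | in_box mu) f [seq val i | i <- mu] =
  \sum_(mu <- box k s) f mu.
Proof. by rewrite big_image. Qed.

Lemma box_uniq k s : uniq (box k s).
Proof.
rewrite map_inj_uniq ?enum_uniq // => mu nu /(inj_map val_inj) eq_mu_nu.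
exact: val_inj.
Qed.

Lemma mem_box k s mu :
  (mu \in box k s) =
  [&& size mu == k, pairwise geq mu & all (fun a => a <= s)%N mu].
Proof.
have geq_trans : transitive geq.
  by move=> b a c le_ba le_cb; apply: leq_trans le_cb le_ba.
apply/imageP/and3P => [[nu nu_box ->]|[/eqP size_mu mu_sorted mu_le]].
  rewrite size_map size_tuple eqxx -sorted_pairwise //; split=> //.
  by apply/allP => a /mapP[i _ ->]; apply: leq_ord.
have size_nu : size [seq inord a : 'I_s.+1 | a <- mu] == k.
  by rewrite size_map size_mu.
have mapK : mu = [seq val i | i <- Tuple size_nu].
  rewrite -map_comp map_id_in // => a /(allP mu_le) le_as /=.
  by rewrite inordK.
by exists (Tuple size_nu) => //; rewrite unfold_in /in_box -mapK sorted_pairwise.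
Qed.

Lemma box0 s : perm_eq (box 0 s) [:: [::]].
Proof.
apply: uniq_perm => [||mu]; rewrite ?box_uniq // mem_box inE.
by case: mu.
Qed.

Lemma boxS0 k : perm_eq (box k.+1 0) [seq 0%N :: mu | mu <- box k 0].
Proof.
have cons_inj : injective (cons 0%N) by move=> ? ? [].
apply: uniq_perm => [||[|a mu]]; first exact: box_uniq.
- by rewrite map_inj_uniq ?box_uniq.
- by rewrite mem_box; apply/esym/mapP => -[].
apply/idP/mapP => [|[nu nu_box [-> ->]]].
  rewrite mem_box /= eqSS leqn0 => /and3P[size_mu /andP[_ ?]].
  by move=> /andP[/eqP-> ?]; exists mu => //; rewrite mem_box; apply/and3P.
by move: nu_box; rewrite !mem_box /= eqSS => /and3P[-> -> ->].
Qed.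

(** Split according to whether the largest part reaches [s.+1]. *)
Lemma boxSS k s :
  perm_eq (box k.+1 s.+1) (box k.+1 s ++ [seq s.+1 :: mu | mu <- box k s.+1]).
Proof.
have cons_inj : injective (cons s.+1) by move=> ? ? [].
apply: uniq_perm => [||mu]; first exact: box_uniq.
  rewrite cat_uniq box_uniq (map_inj_uniq cons_inj) box_uniq andbT /=.
  apply/hasPn => _ /mapP[mu _ ->]; rewrite /= mem_box /= ltnn andbF.
  by rewrite andbF.
rewrite mem_cat; case: mu => [|a mu].
  by rewrite !mem_box /=; apply/esym/mapP => -[].
rewrite !mem_box /= !eqSS.
have -> : (a :: mu \in [seq s.+1 :: mu0 | mu0 <- box k s.+1]) =
          (a == s.+1) && (mu \in box k s.+1).
  by apply/mapP/andP => [[nu nu_box [-> ->]]|[/eqP-> ?]] //; exists mu.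
rewrite mem_box; case: (size mu == k) => //=; last by rewrite andbF.
case: (pairwise geq mu); last by rewrite !andbF.
rewrite !andbT /=; have [a_lt|lt_a|->] := ltngtP a s.+1.
- rewrite -ltnS a_lt orbF; apply: andb_id2l => /allP mu_le /=.
  have mu_le_s : all (fun b => b <= s)%N mu.
    by apply/allP => b /mu_le /leq_trans; apply.
  by rewrite mu_le_s; apply: sub_all mu_le_s => b /leqW.
- by rewrite leqNgt (ltn_trans (ltnSn s) lt_a) !andbF.
- by rewrite ltnn andbF; apply: andbb.
Qed.

(** * Weighted box sums as coefficients of continuants *)

Fixpoint wt c (mu : seq nat) : F :=
  if mu is a :: mu' then Z_ (a + 2 * (c + size mu')) * wt c mu' else 1.

(** A smallest part put at the end raises the offset of all the others, so [c] counts the zeros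
    already removed. *)
Lemma wt_rcons c mu a : wt c (rcons mu a) = wt c.+1 mu * Z_ (a + 2 * c).
Proof.
elim: mu => [|b mu IHmu] /=; first by rewrite addn0 mulrC.
by rewrite size_rcons IHmu addnS mulrA.
Qed.

Definition boxsum c k s : F := \sum_(mu <- box k s) wt c mu.

Lemma boxsum0 c s : boxsum c 0 s = 1.
Proof. by rewrite /boxsum (perm_big _ (box0 s)) big_seq1. Qed.

Lemma boxsumS0 c k : boxsum c k.+1 0 = X_ (c + k) * boxsum c k 0.
Proof.
rewrite /boxsum (perm_big _ (boxS0 k)) big_map big_distrr /=.
apply: eq_big_seq => mu; rewrite mem_box => /andP[/eqP-> _].
by rewrite Z_even.
Qed.

Lemma boxsumSS c k s : boxsum c k.+1 s.+1 =
  boxsum c k.+1 s + Z_ (s.+1 + 2 * (c + k)) * boxsum c k s.+1.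
Proof.
rewrite /boxsum (perm_big _ (boxSS k s)) big_cat (big_map (cons s.+1)) big_distrr /=.
congr (_ + _).
by apply: eq_big_seq => mu; rewrite mem_box => /andP[/eqP-> _].
Qed.

Lemma boxsum_odd c k n : boxsum c k.+1 (2 * n).+1 =
  boxsum c k.+1 (2 * n) + Y_ (n + c + k) * boxsum c k (2 * n).+1.
Proof.
by rewrite boxsumSS (_ : (2 * n).+1 + _ = (2 * (n + c + k)).+1)%N ?Z_odd //; lia.
Qed.

Lemma boxsum_even c k n : boxsum c k.+1 (2 * n) =
  (if n is n'.+1 then boxsum c k.+1 (2 * n').+1 else 0)
  + X_ (n + c + k) * boxsum c k (2 * n).
Proof.
case: n => [|n]; first by rewrite boxsumS0 add0r.
rewrite (_ : 2 * n.+1 = (2 * n).+2)%N; last by lia.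
by rewrite boxsumSS (_ : (2 * n).+2 + _ = (2 * (n.+1 + c + k)))%N ?Z_even //; lia.
Qed.

(** Split off a part [2 * n + 1] (factor Y), then a part [2 * n] (factor X). Returning from bound
    [2 * n] to [2 * n + 1] costs the jump term. The result is the coefficient form of the continuant
    recurrence. *)
Lemma boxsum_rec c k n : boxsum c k.+1 (2 * n).+1 =
  (if n is n'.+1 then boxsum c k.+1 (2 * n').+1 else 0)
  + b_ (n + c + k) * boxsum c k (2 * n).+1
  - jump (n + c + k) * (if k is k'.+1 then boxsum c k' (2 * n).+1 else 0).
Proof.
rewrite boxsum_odd boxsum_even b_E /jump; case: k => [|k].
  by rewrite !boxsum0; ring.
by rewrite [boxsum c k.+1 (2 * n).+1]boxsum_odd addnS /=; ring.
Qed.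

Lemma coef_continuant_gt c L n : (L < n)%N -> (continuant c L)`_n = 0.
Proof.
elim/ltn_ind: L n => -[|L] IH n lt_Ln; first by rewrite coef1; case: n lt_Ln.
case: n lt_Ln => // n lt_Ln.
rewrite /= coefB mulrDl coefD coefXM coefCM coefZ !IH //; last exact: leqW.
case: L IH lt_Ln => [|L] IH lt_Ln; first by rewrite coef0 !mulr0 addr0 subr0.
by rewrite IH ?mulr0 ?addr0 ?subr0 //; lia.
Qed.

Lemma coef_continuant c k n :
  (continuant c (n + k))`_n = boxsum c k (2 * n).+1.
Proof.
have [L] := ubnP (n + k); elim: L n k => // L IH n k.
case: k => [|k] le_nkL.
  rewrite addn0 boxsum0; case: n le_nkL => [|n] le_nL; first by rewrite coef1.
  rewrite /= coefB mulrDl coefD coefXM coefCM coefZ /=.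
  rewrite -[X in (continuant c X)`_n]addn0 IH ?boxsum0; last by lia.
  rewrite coef_continuant_gt // mulr0 addr0.
  by case: n {le_nL} => [|n]; rewrite ?coef0 ?coef_continuant_gt ?mulr0 ?subr0.
rewrite addnS /= coefB mulrDl coefD coefXM coefCM coefZ boxsum_rec.
rewrite addnA [(c + n)%N]addnC; congr (_ + _ * _ - _ * _).
- case: n le_nkL => // n le_nkL; rewrite /= -IH; last by lia.
  by rewrite addnS.
- by apply: IH; lia.
case: k le_nkL => [|k] le_nkL; last by rewrite addnS; apply: IH; lia.
rewrite addn0; case: n {le_nkL} => [|n]; first exact: coef0.
exact: coef_continuant_gt.
Qed.

Lemma coef_cont t k n : (cont t (n + k + 2 * t))`_n = boxsum t k (2 * n).+1.
Proof. by rewrite /cont leq_addl addnK coef_continuant. Qed.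

Lemma coef_cont_small t N n : (N < n + 2 * t)%N -> (cont t N)`_n = 0.
Proof.
move=> lt_N; rewrite /cont; case: leqP => [?|_]; last exact: coef0.
by rewrite coef_continuant_gt //; lia.
Qed.

(** * Removing pairs of extreme parts *)

Lemma s_E n k mu : mu \in box k (2 * n).+1 ->
  s_ n mu = minn (count_mem 0%N mu) (count_mem (2 * n).+1 mu).
Proof.
rewrite mem_box /s_ => /and3P[_]; case: mu => [|a mu] //=.
case: eqVneq => //= neq_an /andP[/allP le_mu _] /andP[le_an _].
(* A head below [2 * n + 1] bounds every part, so that value does not occur and the minimum is
   already 0. *)
have /count_memPn-> : (2 * n).+1 \notin mu; last by rewrite minn0.
apply/negP => /le_mu /= le_na.
by case/negP: neq_an; rewrite eqn_leq le_an.
Qed.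

Lemma s_le_size n k mu : mu \in box k (2 * n).+1 -> (s_ n mu <= size mu)%N.
Proof. by move=> /s_E->; rewrite geq_min count_size. Qed.

Lemma s_short n k mu : mu \in box k (2 * n).+1 -> (k < 2)%N -> s_ n mu = 0%N.
Proof.
move=> mu_box; rewrite (s_E mu_box); move: mu_box.
rewrite mem_box => /and3P[/eqP <- _ _]; case: mu => [|a [|//]] //= _.
by rewrite !addn0; case: a => [|a]; rewrite ?minn0 ?min0n.
Qed.

Lemma s_wrap n k nu : nu \in box k (2 * n).+1 ->
  s_ n ((2 * n).+1 :: rcons nu 0%N) = (s_ n nu).+1.
Proof.
move=> nu_box; rewrite (s_E nu_box) /s_ /= eqxx -cats1 !count_cat /= !addn0.
by rewrite addn1 add0n add1n minnSS.
Qed.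

Lemma mem_box_wrap k s nu :
  (s :: rcons nu 0%N \in box k.+2 s) = (nu \in box k s).
Proof.
rewrite !mem_box /= size_rcons !eqSS pairwise_rcons !all_rcons /= !leqnn.
case: (size nu == k); rewrite //=.
case: (pairwise geq nu); rewrite ?andbF ?andbT //=.
have -> : all (geq^~ 0%N) nu by apply/allP.
by rewrite andbT; apply: andbb.
Qed.

(** Both extreme values occur when [s_] is positive, and monotonicity puts them at the two ends,
    from which they can be stripped. *)
Lemma box_peel k n :
  perm_eq [seq mu <- box k.+2 (2 * n).+1 | 0 < s_ n mu]%N
          [seq (2 * n).+1 :: rcons nu 0%N | nu <- box k (2 * n).+1].
Proof.
set s := (2 * n).+1.
have wrap_inj : injective (fun nu => s :: rcons nu 0%N).
  by move=> nu1 nu2 [] /rcons_inj[].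
apply: uniq_perm => [||mu]; first exact/filter_uniq/box_uniq.
  by rewrite (map_inj_uniq wrap_inj) box_uniq.
rewrite mem_filter; apply/andP/mapP => [[s_gt0 mu_box]|[nu nu_box ->]]; last first.
  by rewrite (s_wrap nu_box) mem_box_wrap.
rewrite (s_E mu_box) leq_min -!has_count !has_pred1 -/s in s_gt0.
have [mu0 mus] := andP s_gt0.
suff [nu Emu] : exists nu, mu = s :: rcons nu 0%N.
  by exists nu => //; rewrite -mem_box_wrap -Emu.
move: mu_box mu0 mus; rewrite mem_box => /and3P[]; clearbody s.
case: mu {s_gt0} => // a mu; case/lastP: mu => [|nu b] // _ /= mu_sorted mu_le.
move: mu_sorted; rewrite pairwise_rcons all_rcons => /and3P[/andP[le_ba le_a] le_b _].
rewrite !inE !mem_rcons !inE => mu0 mus; exists nu.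
have -> : a = s.
  case/andP: mu_le => le_as _; apply/eqP; rewrite eqn_leq le_as /=.
  by case/or3P: mus => [/eqP->|/eqP->|/(allP le_a)].
have -> : b = 0%N; last by [].
apply/eqP; rewrite -leqn0.
by case/or3P: mu0 => [/eqP->|/eqP<-|/(allP le_b)].
Qed.

(* [wt 0 (drop t mu)] is the product of Z's in [u_]: the largest parts come
   first in [mu], and they carry the last [t] factors. *)
Lemma wt_drop c t mu : (t <= size mu)%N ->
  wt c (drop t mu) =
  \prod_(1 <= i < (size mu - t).+1)
    Z_ (nth 0%N mu (size mu - i) + 2 * (c + (i - 1))).
Proof.
elim: mu t => [|a mu IHmu] [|t] //= le_t; first by rewrite big_geq.
  rewrite subn0 big_nat_recr //= subnn subSS subn0 mulrC; congr (_ * _).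
  rewrite -[mu in LHS]drop0 IHmu // subn0 !big_nat; apply: eq_bigr => i.
  by move=> /andP[i_gt0 le_i]; rewrite subSn //.
rewrite IHmu // subSS !big_nat; apply: eq_bigr => i /andP[i_gt0 le_i].
by rewrite subSn //; lia.
Qed.

(** For [phi = qweight (n + k)] and [c = 0] this is the sum of the [u_]; [phi] is arbitrary because
    each removal shifts its argument. *)
Definition peeled_sum (phi : nat -> F) c k n : F :=
  \sum_(mu <- box k (2 * n).+1) phi (s_ n mu) * wt c (drop (s_ n mu) mu).

Lemma peeled_sum_small phi c k n : (k < 2)%N ->
  peeled_sum phi c k n = phi 0%N * boxsum c k (2 * n).+1.
Proof.
move=> lt_k2; rewrite /boxsum big_distrr; apply: eq_big_seq => mu mu_box /=.
by rewrite (s_short mu_box lt_k2) drop0.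
Qed.

(** The case [s_ = 0] is found by complement. Otherwise a pair is removed: [drop] discards the head
    with its factor, while the final zero leaves [X_ c]. *)
Lemma peeled_sumSS phi c k n :
  peeled_sum phi c k.+2 n =
  phi 0%N * (boxsum c k.+2 (2 * n).+1
             - X_ c * Y_ (n + c + k.+1) * boxsum c.+1 k (2 * n).+1)
  + X_ c * peeled_sum (fun t => phi t.+1) c.+1 k n.
Proof.
pose P mu := (0 < s_ n mu)%N.
have sumP (f : seq nat -> F) : \sum_(mu <- box k.+2 (2 * n).+1 | P mu) f mu =
    \sum_(nu <- box k (2 * n).+1) f ((2 * n).+1 :: rcons nu 0%N).
  by rewrite -big_filter (perm_big _ (box_peel k n)) /= (big_map (fun nu => _)).
have wt_wrap nu : nu \in box k (2 * n).+1 ->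
    wt c ((2 * n).+1 :: rcons nu 0%N) =
    X_ c * Y_ (n + c + k.+1) * wt c.+1 nu.
  rewrite mem_box => /andP[/eqP size_nu _].
  rewrite /= wt_rcons add0n Z_even size_rcons size_nu.
  rewrite (_ : (2 * n).+1 + _ = (2 * (n + c + k.+1)).+1)%N; last by lia.
  by rewrite Z_odd; ring.
rewrite /peeled_sum (bigID P) /= sumP.
under [X in _ + X]eq_bigr => mu.
  rewrite /P -eqn0Ngt => /eqP->; rewrite drop0; over.
have -> : \sum_(mu <- box k.+2 (2 * n).+1 | ~~ P mu) phi 0%N * wt c mu =
    phi 0%N * (boxsum c k.+2 (2 * n).+1
               - X_ c * Y_ (n + c + k.+1) * boxsum c.+1 k (2 * n).+1).
  rewrite -big_distrr /= /boxsum [in RHS](bigID P) /= sumP.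
  congr (_ * _); rewrite addrC big_distrr /= (eq_big_seq _ wt_wrap) addrK.
  by [].
rewrite addrC; congr (_ + _); rewrite big_distrr /=; apply: eq_big_seq => nu nu_box.
rewrite (s_wrap nu_box) /= drop_rcons ?(s_le_size nu_box) // wt_rcons.
by rewrite add0n Z_even; ring.
Qed.

Lemma coef_phat n k :
  (phat (n + k))`_n = peeled_sum (qweight (n + k)) 0 k n.
Proof.
set N := (n + k)%N; rewrite phat_sum coef_sum.
pose T t := \prod_(i < t) X_ i * qweight N t *
  ((cont t N)`_n - X_ t * Y_ (N - t.+1) * (cont t.+1 N)`_n).
under eq_bigr do rewrite coefZ coefB coefZ -/(T _).
(* The tail from [t = c] matches the partitions left after [c] removals; each removal lowers [m] by
   two. *)
suff IH m c : (n + m + 2 * c)%N = N ->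
    \sum_(c <= t < N.+1) T t =
    \prod_(i < c) X_ i * peeled_sum (fun t => qweight N (c + t)) c m n.
  by rewrite (IH k 0%N) ?addn0 // big_ord0 mul1r.
have [M] := ubnP m; elim: M m c => // M IHM m c lt_mM eN.
rewrite big_ltn; last by lia.
have -> : T c = \prod_(i < c) X_ i * qweight N c * (boxsum c m (2 * n).+1
    - X_ c * Y_ (N - c.+1) * (cont c.+1 N)`_n) by rewrite /T -{2}eN coef_cont.
(* For [m < 2], [cont t N] with [t > c] has degree less than [n], so only the term [t = c]
   remains. *)
have [lt_m2|le_2m] := ltnP m 2.
  rewrite peeled_sum_small // addn0 coef_cont_small; last by lia.
  rewrite mulr0 subr0 big_nat [X in _ + X]big1 ?addr0 ?mulrA // => t /andP[lt_ct _].
  by rewrite /T !coef_cont_small ?mulr0 ?subr0 ?mulr0 //; lia.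
case: m le_2m lt_mM eN => [|[|m]] // _ lt_mM eN.
rewrite peeled_sumSS addn0 (IHM m c.+1); [|by lia..].
rewrite -[in cont c.+1 _](_ : n + m + 2 * c.+1 = N)%N; last by lia.
rewrite coef_cont (_ : N - c.+1 = n + c + m.+1)%N; last by lia.
have -> : peeled_sum (fun t => qweight N (c.+1 + t)) c.+1 m n =
    peeled_sum (fun t => qweight N (c + t.+1)) c.+1 m n.
  by apply: eq_bigr => mu _; rewrite addSnnS.
by rewrite big_ord_recr /=; ring.
Qed.

End Generic.

Theorem theorem2p3 (K : idomainType) (n k : nat) :
  let alpha := indet K 0 in
  let beta := indet K 1 in
  let eps1 := indet K 2 in
  let eps2 := indet K 3 in
  let q := indet K 4 in
  (phat alpha beta eps1 eps2 q (n + k))`_n =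
  \sum_(mu : k.-tuple 'I_(2 * n + 1).+1 | in_box mu)
    u_ alpha beta eps1 eps2 q n [seq val i | i <- mu].
Proof.
move=> alpha beta eps1 eps2 q.
(* Evaluating all variables at 0 refutes q^i = 1; evaluating them at 1 below refutes q = 0. *)
have expq_neq1 i : (0 < i)%N -> q ^+ i != 1.
  move=> i_gt0; rewrite -tofracXn -tofrac1 tofrac_eq.
  apply/negP => /eqP/(congr1 (meval (fun=> 0))).
  rewrite rmorphXn rmorph1 /= mevalXU expr0n; case: i i_gt0 => // i _.
  by move/eqP; rewrite eq_sym oner_eq0.
have q_neq0 : q != 0.
  rewrite tofrac_eq0; apply/negP => /eqP/(congr1 (meval (fun=> 1))).
  by rewrite rmorph0 mevalXU => /eqP; rewrite oner_eq0.
rewrite coef_phat // addn1 (big_box k (2 * n).+1 (u_ alpha beta eps1 eps2 q n)).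
apply: eq_big_seq => mu mu_box; rewrite /u_ wt_drop ?(s_le_size mu_box) //.
move: mu_box; rewrite mem_box => /andP[/eqP-> _].
by rewrite /qweight mulrC mulrA.
Qed.
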